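(* Let $m,n\ge 1$ be integers and let $a_1,\dots,a_m,b_1,\dots,b_n$ be positive real numbers. Consider the toy scattering model with $m$ type A particles of speeds $a_1,\dots,a_m$ and $n$ type B particles of speeds $b_1,\dots,b_n$. Put $$f_a(t)=\prod_{j=1}^{m}\frac{1}{1+ia_jt}\,\prod_{k=1}^{n}\frac{1}{1-ib_kt}\,\frac1t .$$ Let $C$ be a positively oriented closed contour in $\mathbb{C}$ which, among the poles of $f_a$, surrounds only the $a$-poles, i.e. it surrounds all the points $i/a_1,\dots,i/a_m$ and surrounds neither $0$ nor any of the points $-i/b_1,\dots,-i/b_n$. Then $$P(\text{A wins})=-\frac{1}{2\pi i}\oint_{C}\prod_{j=1}^{m}\frac{1}{1+ia_jt}\,\prod_{k=1}^{n}\frac{1}{1-ib_kt}\,\frac1t\,dt=-\sum_{j=1}^{m}\operatorname{Residue}\left(i\,a_j^{-1},f_a(t)\right),$$ where $\operatorname{Residue}(z_0,f_a(t))$ denotes the residue of $f_a$ at $t=z_0$.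
   Context: Toy scattering model. There are $m$ type A particles $A_1,\dots,A_m$ with speeds $a_1,\dots,a_m>0$ and $n$ type B particles $B_1,\dots,B_n$ with speeds $b_1,\dots,b_n>0$ on an infinite line. Type A particles move in the positive direction and type B particles in the negative direction, each at constant speed, and initially all type B particles are to the right of all type A particles. Particles of the same type pass freely through each other with unchanged velocities. When a type A particle of speed $a$ and a type B particle of speed $b$ collide, exactly one of them is annihilated: the type A particle survives with probability $a/(a+b)$ and the type B particle survives with probability $b/(a+b)$, independently of the other collisions; the survivor continues with unchanged speed and direction. The process continues until only one type of particle survives. ''A wins'' is the event that all type B particles are annihilated.
   Formalization: The sum of residues is taken over the distinct points i/a_j, each counted once, instead of over all j=1,…,m; with repeated speeds the literal sum is false (m=2, n=1, all speeds 1: P=3/4, but the literal sum gives 3/2). *)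

(* Defs.v *)
From HB Require Import structures.
From mathcomp Require Import all_boot all_order all_algebra.
From mathcomp Require Import complex.
From mathcomp Require Import all_classical all_reals all_analysis.

Set Implicit Arguments.
Unset Strict Implicit.
Unset Printing Implicit Defensive.

Import Order.TTheory GRing.Theory Num.Theory.
Import numFieldNormedType.Exports.

Local Open Scope classical_set_scope.
Local Open Scope ring_scope.
Local Open Scope complex_scope.

(** ** The scattering process *)

(* Time at which A_j, started at x j with velocity a j, meets B_k, started at
   y k with velocity - b k. *)
Definition collision_time (R : realType) (m n : nat)
    (a : 'I_m -> R) (b : 'I_n -> R) (x : 'I_m -> R) (y : 'I_n -> R)
    (j : 'I_m) (k : 'I_n) : R :=
  (y k - x j) / (a j + b k).

(* [next SA SB] is an A-B pair that collides first when SA and SB are the sets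
   of surviving particles. For initial positions in general position the pair
   is unique; when several pairs meet at the same instant, [next] is any rule
   saying which of these collisions is treated first. *)
Definition next_collision (R : realType) (m n : nat)
    (a : 'I_m -> R) (b : 'I_n -> R) (x : 'I_m -> R) (y : 'I_n -> R)
    (next : {set 'I_m} -> {set 'I_n} -> 'I_m * 'I_n) : Prop :=
  forall (SA : {set 'I_m}) (SB : {set 'I_n}),
    SA != finset.set0 -> SB != finset.set0 ->
    [/\ (next SA SB).1 \in SA, (next SA SB).2 \in SB &
      forall j k, j \in SA -> k \in SB ->
        collision_time a b x y (next SA SB).1 (next SA SB).2
          <= collision_time a b x y j k].

(* One collision. [survives (j, k)] is the event that A_j survives its
   collision with B_k; a given pair collides at most once, so each of these
   events is consulted at most once in a run. *)
Definition collide (T : Type) (m n : nat)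
    (next : {set 'I_m} -> {set 'I_n} -> 'I_m * 'I_n)
    (survives : 'I_m * 'I_n -> set T) (w : T)
    (s : {set 'I_m} * {set 'I_n}) : {set 'I_m} * {set 'I_n} :=
  if (s.1 == finset.set0) || (s.2 == finset.set0) then s
  else let p := next s.1 s.2 in
    if w \in survives p then (s.1, s.2 :\ p.2)%SET else (s.1 :\ p.1, s.2)%SET.

Definition A_wins (T : Type) (m n : nat)
    (next : {set 'I_m} -> {set 'I_n} -> 'I_m * 'I_n)
    (survives : 'I_m * 'I_n -> set T) : set T :=
  [set w | exists N : nat,
    (iter N (collide next survives w) (finset.setT, finset.setT)).2
      = finset.set0].

Definition mutually_independent (R : realType) (d : measure_display)
    (T : measurableType d) (P : probability T R) (I : finType)
    (E : I -> set T) : Prop :=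
  forall J : {set I},
    P (\bigcap_(i in [set i | i \in J]) E i) = (\prod_(i in J) P (E i))%E.

(** ** Contours *)

Definition C1_on (R : realType) (g : R -> R) (u v : R) : Prop :=
  exists h : R -> R,
    {within `[u, v], continuous h} /\
    (forall t, u < t < v -> is_derive t 1 g (h t)).

(* A closed piecewise C^1 path parametrized by [0, 1]; [s] lists the
   breakpoints 0 = s_0 < s_1 < ... < s_N = 1, without s_0. *)
Definition closed_contour (R : realType) (gamma : R -> R[i]) : Prop :=
  [/\ {within `[0, 1], continuous (fun t => complex.Re (gamma t))},
      {within `[0, 1], continuous (fun t => complex.Im (gamma t))},
      gamma 0 = gamma 1 &
      exists s : seq R,
        [/\ path (fun u v => u < v) 0 s, last 0 s = 1 &
          forall i, (i < size s)%N ->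
            C1_on (fun t => complex.Re (gamma t)) (nth 0 (0 :: s) i) (nth 0 s i) /\
            C1_on (fun t => complex.Im (gamma t)) (nth 0 (0 :: s) i) (nth 0 s i)]].

(* [gamma] avoids z and the argument of [gamma t - z], followed continuously,
   changes by 2 pi k along the path. *)
Definition winds (R : realType) (gamma : R -> R[i]) (z : R[i]) (k : int) :
    Prop :=
  (forall t, 0 <= t <= 1 -> gamma t != z) /\
  exists theta : R -> R,
    [/\ {within `[0, 1], continuous theta},
        forall t, 0 <= t <= 1 ->
          gamma t - z = `|gamma t - z| * (cos (theta t) +i* sin (theta t)) &
        theta 1 - theta 0 = 2 * pi * k%:~R].

(* A contour is not assumed to be simple: [gamma] surrounds z positively if it
   goes around z once counterclockwise. *)
Definition surrounds (R : realType) (gamma : R -> R[i]) (z : R[i]) : Prop :=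
  winds gamma z 1.

Definition does_not_surround (R : realType) (gamma : R -> R[i]) (z : R[i]) :
    Prop :=
  winds gamma z 0.

Definition path_derivative (R : realType) (gamma : R -> R[i]) (t : R) : R[i] :=
  derive1 (fun s => complex.Re (gamma s)) t
    +i* derive1 (fun s => complex.Im (gamma s)) t.

(* The finitely many breakpoints, where [path_derivative] is meaningless, form
   a null set. *)
Definition contour_integral (R : realType) (gamma : R -> R[i])
    (f : R[i] -> R[i]) : R[i] :=
  (\int[lebesgue_measure]_(t in `[0, 1])
     complex.Re (f (gamma t) * path_derivative gamma t)) +i*
  (\int[lebesgue_measure]_(t in `[0, 1])
     complex.Im (f (gamma t) * path_derivative gamma t)).

(** ** Residues *)

(* [r] is the coefficient of (t - z0)^-1 in the Laurent expansion of a function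
   with at most a pole at z0: f is a principal part plus a function [g]
   holomorphic near z0. *)
Definition is_residue (R : realType) (z0 : R[i]) (f : R[i] -> R[i])
    (r : R[i]) : Prop :=
  exists (N : nat) (c : nat -> R[i]) (g : R[i]^o -> R[i]^o),
    [/\ r = c 0%N,
        \forall t \near (z0 : R[i]^o), derivable g t 1 &
        \forall t \near (z0 : R[i]^o)^',
          f t = \sum_(k < N.+1) c k / (t - z0) ^+ k.+1 + g t].

(* The principal part is unique, so this is the residue whenever f has at most
   a pole at z0; the value 0 is used otherwise. *)
Definition Residue (R : realType) (z0 : R[i]) (f : R[i] -> R[i]) : R[i] :=
  xget 0 [set r | is_residue z0 f r].

Definition f_a (R : realType) (m n : nat) (a : 'I_m -> R) (b : 'I_n -> R)
    (t : R[i]) : R[i] :=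
  (\prod_(j < m) (1 / (1 + 'i%C * (a j)%:C * t))) *
  (\prod_(k < n) (1 / (1 - 'i%C * (b k)%:C * t))) * (1 / t).

(* Main.v *)
Require Import Defs.
From HB Require Import structures.
From mathcomp Require Import all_boot all_order all_algebra.
From mathcomp Require Import complex ring.
From mathcomp Require Import all_classical all_reals all_analysis.
From mathcomp Require Import measurable_realfun.

(** Write f_(S, S') for f_a restricted to the surviving particles. The identity
    1 / ((1 + iat)(1 - ibt))
      = a / (a + b) * 1 / (1 + iat) + b / (a + b) * 1 / (1 - ibt)
    says that - (1 / 2 pi i) times the contour integral of f_(S, S') obeys the
    one-step recursion of the winning probability, whichever pair collides
    first; hence the order of the collisions, and so the positions, are
    irrelevant. The boundary values 1 (S' empty) and 0 (S empty) and the residue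
    formula come from partial fractions: along the contour (t - z)^-(k + 1) has
    a primitive, which is single-valued for k > 0 and is a branch of log (t - z)
    for k = 0. *)

Set Implicit Arguments.
Unset Strict Implicit.
Unset Printing Implicit Defensive.

Import Order.TTheory GRing.Theory Num.Theory.
Import numFieldNormedType.Exports.
Local Open Scope classical_set_scope.
Local Open Scope ring_scope.
Local Open Scope complex_scope.

(** * Partial fractions *)

(** The contour need not be simple and is known only through a continuous choice of argument around
    each pole. Every integral is therefore the increment of an explicit primitive along the path,
    and the fundamental theorem of calculus on each smooth piece suffices.

    The boundary value for an exhausted B side rests on the sum of all simple-pole coefficients of a
    partial fraction decomposition. It is the coefficient of 1/t at infinity, so it vanishes as soon
    as a product has two factors 1/(t - v); if every pole is encircled once, the integral then
    vanishes too. The identity 1/((1 + iat)t) = 1/t - ia/(1 + iat) removes one A particle at the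
    price of a product of A factors alone, to which this applies.

    On the probability side, independence is given for intersections of the events that A particles
    survive, while the recursion also involves their complements. A failure is therefore treated as
    a difference of two events, each conditioned on survivals only. *)

(* The triple (c, z, k) encodes the term c / (t - z)^(k + 1). *)
Definition pf_eval (F : fieldType) (s : seq (F * F * nat)) (t : F) : F :=
  \sum_(q <- s) q.1.1 / (t - q.1.2) ^+ q.2.+1.

Definition pf_res (F : fieldType) (s : seq (F * F * nat)) (z : F) : F :=
  \sum_(q <- s | (q.1.2 == z) && (q.2 == 0%N)) q.1.1.

Definition pf_poles_in (F : fieldType) (S : seq F) (s : seq (F * F * nat)) :=
  all (fun q => q.1.2 \in S) s.

(** The product decays like t^-2 at infinity, so its 1/t coefficient there, which is the sum of the
    simple-pole coefficients, is 0. If z = w the exponent just grows and no simple pole appears. *)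
Lemma pf_term_mul (F : fieldType) (S : seq F) (z w c : F) (k : nat) :
  z \in S -> w \in S ->
  exists s, [/\ pf_poles_in S s,
    forall t, t \notin S -> c / (t - z) ^+ k.+1 * (1 / (t - w)) = pf_eval s t &
    \sum_(q <- s | q.2 == 0%N) q.1.1 = 0].
Proof.
move=> zS wS.
have neq t v : t \notin S -> v \in S -> t - v != 0.
  by move=> tS vS; rewrite subr_eq0; apply: contraNneq tS => ->.
have [<-{w wS}|zw] := eqVneq z w.
  exists [:: (c, z, k.+1)]; split.
  - by rewrite /pf_poles_in /= zS.
  - move=> t tS; rewrite /pf_eval big_seq1 /= [in RHS]exprS.
    have tz : t - z != 0 by exact: neq.
    by field; rewrite tz expf_neq0.
  - by rewrite big_cons big_nil.
have zw0 : z - w != 0 by rewrite subr_eq0.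
elim: k c => [|k IHk] c.
  exists [:: (c / (z - w), z, 0%N); (- (c / (z - w)), w, 0%N)]; split.
  - by rewrite /pf_poles_in /= zS wS.
  - move=> t tS; rewrite /pf_eval big_cons big_seq1 /= !expr1.
    by field; rewrite zw0 !neq.
  - by rewrite !big_cons big_nil /= addr0 subrr.
have [s [sS sE s0]] := IHk (- (c / (z - w))).
exists ((c / (z - w), z, k.+1) :: s); split.
- by rewrite /pf_poles_in /= zS.
- move=> t tS; rewrite /pf_eval big_cons /= -/(pf_eval s t) -sE//.
  rewrite (exprS _ k.+1); set p := (t - z) ^+ k.+1.
  have p0 : p != 0 by rewrite expf_neq0// neq.
  by field; rewrite zw0 p0 !neq.
- by rewrite big_cons.
Qed.

Lemma pf_eval_mul (F : fieldType) (S : seq F) (w : F) (s : seq (F * F * nat)) :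
  pf_poles_in S s -> w \in S ->
  exists s', [/\ pf_poles_in S s',
    forall t, t \notin S -> pf_eval s t * (1 / (t - w)) = pf_eval s' t &
    \sum_(q <- s' | q.2 == 0%N) q.1.1 = 0].
Proof.
move=> + wS; elim: s => [_|[[c z] k] s IHs /andP[/= zS /IHs[s2 [s2S s2E s20]]]].
  by exists [::]; split => //; [move=> t _; rewrite /pf_eval !big_nil mul0r|
    rewrite big_nil].
have [s1 [s1S s1E s10]] := pf_term_mul c k zS wS.
exists (s1 ++ s2); split; first by rewrite /pf_poles_in all_cat; exact/andP.
- move=> t tS; rewrite /pf_eval big_cat big_cons /= mulrDl.
  by rewrite s1E// s2E.
- by rewrite big_cat /= s10 s20 addr0.
Qed.

(** A single factor 1/(t - w) contributes the coefficient 1; from the second factor on, the sum of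
    the simple-pole coefficients is 0. *)
Lemma pf_prod (F : fieldType) (S : seq F) (w : F) (ws : seq F) :
  w \in S -> all [in S] ws ->
  exists s, [/\ pf_poles_in S s,
    forall t, t \notin S -> \prod_(v <- w :: ws) (1 / (t - v)) = pf_eval s t &
    \sum_(q <- s | q.2 == 0%N) q.1.1 = (ws == [::])%:R].
Proof.
move=> wS; elim: ws => [_|v ws IHws /andP[vS /IHws[s [sS sE _]]]].
  exists [:: (1, w, 0%N)]; split.
  - by rewrite /pf_poles_in /= wS.
  - by move=> t tS; rewrite /pf_eval !big_seq1.
  - by rewrite big_cons big_nil addr0.
have [s' [s'S s'E s'0]] := pf_eval_mul sS vS.
exists s'; split => // t tS.
rewrite -s'E// -sE// !big_cons; by ring.
Qed.

Lemma sum_pf_res (F : fieldType) (S : seq F) (s : seq (F * F * nat)) : uniq S ->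
  \sum_(z <- S) pf_res s z
  = \sum_(q <- s | (q.1.2 \in S) && (q.2 == 0%N)) q.1.1.
Proof.
move=> uS; rewrite /pf_res.
under eq_bigr do rewrite big_mkcond.
rewrite exchange_big [RHS]big_mkcond /=; apply: eq_bigr => q _.
rewrite -big_mkcond /=; case: (boolP (q.2 == 0%N)) => q0; last first.
  by rewrite andbF big1// => i; rewrite andbF.
rewrite andbT; under eq_bigl do rewrite andbT.
case: (boolP (q.1.2 \in S)) => qS.
  rewrite (big_rem q.1.2)//= eqxx big_seq_cond big1 ?addr0// => i.
  by move=> /andP[+ /eqP qi]; rewrite -qi mem_rem_uniqF.
by rewrite big_seq_cond big1// => i /andP[iS /eqP qi]; rewrite qi iS in qS.
Qed.

(** * The fundamental theorem of calculus on a subdivided interval *)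

(** [phi] is compared with the derivative inside the interval only: at a breakpoint the integrand
    takes an arbitrary value, and the two endpoints form a null set. Measurability is recorded
    because gluing consecutive pieces requires it. *)
Lemma FTC2_itvcc (R : realType) (u v : R) (F phi h : R -> R) : u < v ->
  {within `[u, v], continuous h} -> {within `[u, v], continuous F} ->
  (forall t, u < t < v -> is_derive t 1 F (h t)) ->
  (forall t, u < t < v -> phi t = h t) ->
  measurable_fun (`[u, v] : set R) phi /\
  (\int[lebesgue_measure]_(t in `[u, v]) (phi t)%:E = (F v - F u)%:E)%E.
Proof.
move=> uv ch cF dF phih.
have mh : measurable_fun (`]u, v[ : set R) h.
  apply: (@measurable_funS _ _ _ _ `[u, v]) => //.
    exact: subset_itv_oo_cc.
  exact: subspace_continuous_measurable_fun.
have mphi : measurable_fun (`]u, v[ : set R) phi.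
  apply: (eq_measurable_fun h) => // t; rewrite inE/= in_itv/= => tuv.
  by rewrite phih.
split; first exact: measurable_fun_itv_cc mphi.
rewrite (eq_integral_itv_bounded true false mphi mh); last first.
  by move=> t; rewrite in_itv/= => /phih.
rewrite EFinB; apply: continuous_FTC2 => //.
  have /continuous_within_itvP := cF => /(_ uv)[_ cu cv].
  by split=> // t; rewrite in_itv/= => /dF [].
by move=> t; rewrite in_itv/= => /dF[_ dt]; rewrite derive1E.
Qed.

Lemma FTC2_piecewise (R : realType) (phi F : R -> R) (u : R) (s : seq R) :
  s != [::] -> path (fun u v => u < v) u s ->
  (forall i, (i < size s)%N ->
    measurable_fun (`[nth 0 (u :: s) i, nth 0 s i] : set R) phi /\
    (\int[lebesgue_measure]_(t in `[nth 0%R (u :: s) i, nth 0%R s i]) (phi t)%:E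
     = (F (nth 0%R s i) - F (nth 0%R (u :: s) i))%:E)%E) ->
  measurable_fun (`[u, last u s] : set R) phi /\
  (\int[lebesgue_measure]_(t in `[u, last u s]) (phi t)%:E
    = (F (last u s) - F u)%:E)%E.
Proof.
case: s => // v s _; elim: s u v => [|w s IHs] u v.
  by move=> /= _ /(_ 0%N); apply.
move=> /= /andP[uv pvs] H.
have [||mv Iv] := IHs v w; first exact: pvs.
  by move=> i si; have /= := H i.+1 si.
have [/= mu Iu] := H 0%N isT.
have vl : v < last w s.
  have /allP := @order_path_min _ _ v (w :: s) (@lt_trans _ R) pvs; apply.
  exact: mem_last.
(* The second piece is taken half-open to make the union disjoint; its missing left endpoint does
   not change the integral. *)
have E : [set` `[u, last w s]] = [set` `[u, v]] `|` [set` `]v, last w s]] :> set R.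
  by apply: itv_bndbnd_setU; rewrite bnd_simp ltW.
have mvo : measurable_fun (`]v, last w s] : set R) phi.
  exact: measurable_fun_itv_oc mv.
have mE : measurable_fun (`[u, last w s] : set R) phi.
  by rewrite E; apply/measurable_funU.
split=> //; rewrite E integral_setU_EFin//; last 2 first.
- by rewrite -E.
- apply/disj_setPS => y [/=]; rewrite !in_itv/= => /andP[_ yx] /andP[].
  by rewrite ltNge yx.
rewrite Iu integral_itv_obnd_cbnd; last exact/measurable_EFinP.
by rewrite Iv -EFinD addrC addrA subrK.
Qed.

(** * Complex-valued functions of a real variable *)

(** Derivatives and continuity are taken on real and imaginary parts, as in the definitions of
    contours and of their integrals, so that the real fundamental theorem applies to each part. *)
Definition is_cderive (R : realType) (G : R -> R[i]) (t : R) (d : R[i]) : Prop :=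
  is_derive t 1 (fun s => complex.Re (G s)) (complex.Re d) /\
  is_derive t 1 (fun s => complex.Im (G s)) (complex.Im d).

Definition ccontinuous_on (R : realType) (A : set R) (G : R -> R[i]) : Prop :=
  {within A, continuous (fun s => complex.Re (G s))} /\
  {within A, continuous (fun s => complex.Im (G s))}.

Section CCalculus.
Context {R : realType}.
Implicit Types (F G : R -> R[i]) (A : set R) (t : R) (d e c : R[i]).

Lemma cReD (x y : R[i]) : complex.Re (x + y) = complex.Re x + complex.Re y.
Proof. by case: x y => [? ?] [? ?]. Qed.
Lemma cImD (x y : R[i]) : complex.Im (x + y) = complex.Im x + complex.Im y.
Proof. by case: x y => [? ?] [? ?]. Qed.
Lemma cReN (x : R[i]) : complex.Re (- x) = - complex.Re x.
Proof. by case: x. Qed.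
Lemma cImN (x : R[i]) : complex.Im (- x) = - complex.Im x.
Proof. by case: x. Qed.
Lemma cReM (x y : R[i]) : complex.Re (x * y) =
  complex.Re x * complex.Re y - complex.Im x * complex.Im y.
Proof. by case: x y => [? ?] [? ?]. Qed.
Lemma cImM (x y : R[i]) : complex.Im (x * y) =
  complex.Re x * complex.Im y + complex.Im x * complex.Re y.
Proof. by case: x y => [? ?] [? ?]. Qed.
Lemma cReV (x : R[i]) : complex.Re x^-1 =
  complex.Re x / (complex.Re x ^+ 2 + complex.Im x ^+ 2).
Proof. by case: x. Qed.
Lemma cImV (x : R[i]) : complex.Im x^-1 =
  - (complex.Im x / (complex.Re x ^+ 2 + complex.Im x ^+ 2)).
Proof. by case: x. Qed.

Lemma sum_sqr_ReIm_gt0 (x : R[i]) : x != 0 ->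
  0 < complex.Re x ^+ 2 + complex.Im x ^+ 2.
Proof.
case: x => x y; rewrite eq_complex /= negb_and => xy.
rewrite lt_neqAle addr_ge0 ?sqr_ge0// andbT eq_sym paddr_eq0 ?sqr_ge0//.
by rewrite !sqrf_eq0 negb_and.
Qed.

Lemma is_cderive_ext F G t d : F =1 G -> is_cderive F t d -> is_cderive G t d.
Proof. by move=> /funext ->. Qed.

Lemma is_cderive_cst c t : is_cderive (fun=> c) t 0.
Proof. by split; exact: is_derive_cst. Qed.

Lemma is_cderiveD F G t d e : is_cderive F t d -> is_cderive G t e ->
  is_cderive (fun s => F s + G s) t (d + e).
Proof.
move=> [dF1 dF2] [dG1 dG2]; split.
- rewrite cReD; under eq_fun do rewrite cReD; exact: is_deriveD.
- rewrite cImD; under eq_fun do rewrite cImD; exact: is_deriveD.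
Qed.

Lemma is_cderiveM F G t d e : is_cderive F t d -> is_cderive G t e ->
  is_cderive (fun s => F s * G s) t (F t * e + G t * d).
Proof.
move=> [dF1 dF2] [dG1 dG2]; split.
- under eq_fun do rewrite cReM.
  apply: is_derive_eq.
  by rewrite /= cReD !cReM /GRing.scale /=; ring.
- under eq_fun do rewrite cImM.
  apply: is_derive_eq.
  by rewrite /= cImD !cImM /GRing.scale /=; ring.
Qed.

Lemma is_cderiveV F t d : F t != 0 -> is_cderive F t d ->
  is_cderive (fun s => (F s)^-1) t (- (F t) ^- 2 * d).
Proof.
move=> Ft0 [dF1 dF2].
have n0 := lt0r_neq0 (sum_sqr_ReIm_gt0 Ft0).
set n := fun s => complex.Re (F s) ^+ 2 + complex.Im (F s) ^+ 2.
have dn : is_derive t 1 n (complex.Re (F t) * complex.Re d *+ 2 +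
    complex.Im (F t) * complex.Im d *+ 2).
  rewrite /n; apply: is_derive_eq.
  by rewrite /GRing.scale /=; ring.
have dV : is_derive t 1 (fun s => (n s)^-1) (- (n t) ^- 2 *:
    (complex.Re (F t) * complex.Re d *+ 2 +
    complex.Im (F t) * complex.Im d *+ 2)).
  exact: is_deriveV.
have E : - F t ^- 2 * d = - (((F t)^-1 * (F t)^-1) * d).
  by rewrite -exprVn expr2 mulNr.
rewrite E; split.
- under eq_fun do rewrite cReV -/(n _).
  apply: is_derive_eq.
  rewrite cReN !(cReM, cReV, cImV, cImM) /GRing.scale /= /n.
  by field.
- under eq_fun do rewrite cImV -/(n _).
  apply: is_derive_eq.
  rewrite cImN !(cReM, cReV, cImV, cImM) /GRing.scale /= /n.
  by field.
Qed.

Lemma is_cderiveX F t d (k : nat) : is_cderive F t d ->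
  is_cderive (fun s => F s ^+ k.+1) t (k.+1%:R * F t ^+ k * d).
Proof.
move=> dF; elim: k => [|k IHk].
  by rewrite expr0 !mul1r.
have := is_cderiveM dF IHk.
suff -> : k.+2%:R * F t ^+ k.+1 * d
  = F t * (k.+1%:R * F t ^+ k * d) + F t ^+ k.+1 * d.
  by apply: is_cderive_ext => s; rewrite -exprS.
by rewrite exprS -(natr1 k.+1); ring.
Qed.

Lemma ccontinuous_cst A c : ccontinuous_on A (fun=> c).
Proof. by split=> x; exact: cvg_cst. Qed.

Lemma ccontinuousD A F G : ccontinuous_on A F -> ccontinuous_on A G ->
  ccontinuous_on A (fun s => F s + G s).
Proof.
move=> [F1 F2] [G1 G2]; split=> x.
- under eq_fun do rewrite cReD; apply: cvgD; [exact: F1|exact: G1].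
- under eq_fun do rewrite cImD; apply: cvgD; [exact: F2|exact: G2].
Qed.

Lemma ccontinuousM A F G : ccontinuous_on A F -> ccontinuous_on A G ->
  ccontinuous_on A (fun s => F s * G s).
Proof.
move=> [F1 F2] [G1 G2]; split=> x.
- under eq_fun do rewrite cReM.
  by apply: cvgB; apply: cvgM; [exact: F1|exact: G1|exact: F2|exact: G2].
- under eq_fun do rewrite cImM.
  by apply: cvgD; apply: cvgM; [exact: F1|exact: G2|exact: F2|exact: G1].
Qed.

Lemma ccontinuousV A F : (forall s, A s -> F s != 0) ->
  ccontinuous_on A F -> ccontinuous_on A (fun s => (F s)^-1).
Proof.
move=> F0 [F1 F2].
have cn : {within A, continuous (fun s =>
    (complex.Re (F s) ^+ 2 + complex.Im (F s) ^+ 2)^-1)}.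
  move: F1 F2 => /subspace_continuousP F1 /subspace_continuousP F2.
  apply/subspace_continuousP => x Ax.
  apply: cvgV; first by rewrite lt0r_neq0// sum_sqr_ReIm_gt0// F0.
  apply: cvgD; apply: cvgM;
    by [exact: F1|exact: F2].
split=> x.
- under eq_fun do rewrite cReV.
  by apply: cvgM; [exact: F1|exact: cn].
- under eq_fun do rewrite cImV.
  by apply: cvgN; apply: cvgM; [exact: F2|exact: cn].
Qed.

Lemma ccontinuousX A F (k : nat) : ccontinuous_on A F ->
  ccontinuous_on A (fun s => F s ^+ k.+1).
Proof.
move=> cF; elim: k => [//|k IHk].
by under eq_fun do rewrite exprS; exact: ccontinuousM.
Qed.

End CCalculus.

(** * Contour integrals by primitives *)

(** A certificate for the value [v]: [G] is a primitive of the integrand along the path. Its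
    derivative is prescribed only where [gamma] has one; across breakpoints only continuity is
    asked. Such certificates add and scale without any integrability argument. *)
Definition is_contour_integral (R : realType) (gamma : R -> R[i])
    (f : R[i] -> R[i]) (v : R[i]) : Prop :=
  exists phi G : R -> R[i],
    [/\ forall t, 0 <= t <= 1 -> f (gamma t) = phi t,
      ccontinuous_on `[0, 1] phi, ccontinuous_on `[0, 1] G,
      forall t d, 0 < t < 1 -> is_cderive gamma t d ->
        is_cderive G t (phi t * d) & G 1 - G 0 = v].

Lemma path_lt_nth_bounds (R : realType) (u : R) (s : seq R) (i : nat) :
  path (fun u v => u < v) u s -> (i < size s)%N ->
  [/\ u <= nth 0 (u :: s) i, nth 0 (u :: s) i < nth 0 s i &
    nth 0 s i <= last u s].
Proof.
elim: s u i => // v s IHs u [|i] /= /andP[uv pvs] si.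
  split=> //; have /allP vs := @order_path_min _ _ v s (@lt_trans _ R) pvs.
  by have := mem_last v s; rewrite inE => /predU1P[->//|/vs/ltW].
by have [vi ii il] := IHs v i pvs si; split=> //; rewrite (le_trans (ltW uv)).
Qed.

(** On each smooth piece the integral is the increment of [G], and these increments telescope
    because [G] is continuous across the breakpoints. *)
Lemma contour_integralE (R : realType) (gamma : R -> R[i])
    (f : R[i] -> R[i]) (v : R[i]) :
  closed_contour gamma -> is_contour_integral gamma f v ->
  contour_integral gamma f = v.
Proof.
move=> [_ _ _ [s [ps ls H]]] [phi [G [fphi [cf1 cf2] [cG1 cG2] dG Gv]]].
have s0 : s != [::] by case: s ls {ps H} => //= /eqP; rewrite eq_sym oner_eq0.
have sub u v' : 0 <= u -> v' <= 1 -> `[u, v'] `<=` (`[0, 1] : set R).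
  by move=> u0 v1; apply: subset_itvScc; rewrite bnd_simp.
(* [h1] and [h2] are the continuous extensions of the derivatives of [gamma] to the closed piece,
   which [path_derivative] need not be. *)
have pw i : (i < size s)%N -> exists h1 h2 : R -> R,
    [/\ {within `[nth 0 (0 :: s) i, nth 0 s i], continuous h1},
        {within `[nth 0 (0 :: s) i, nth 0 s i], continuous h2} &
     forall t, nth 0 (0 :: s) i < t < nth 0 s i ->
       f (gamma t) * path_derivative gamma t = phi t * (h1 t +i* h2 t) /\
       is_cderive G t (phi t * (h1 t +i* h2 t))].
  move=> si; have [[h1 [ch1 dh1]] [h2 [ch2 dh2]]] := H i si.
  have [u0 uv v1] := path_lt_nth_bounds ps si.
  exists h1, h2; split=> // t /[dup] /andP[ut tv] tuv.
  have dg : is_cderive gamma t (h1 t +i* h2 t).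
    by split; [exact: dh1|exact: dh2].
  have t01 : 0 < t < 1 by rewrite (le_lt_trans u0 ut)/= -ls (lt_le_trans tv).
  split; last exact: dG.
  rewrite fphi; last by case/andP: t01 => /ltW -> /ltW ->.
  by rewrite /path_derivative !derive1E; case: dg => [[_ /= ->] [_ /= ->]].
rewrite -Gv /contour_integral; set f1 := fun t => complex.Re _.
set f2 := fun t => complex.Im _.
have [_ I1] : measurable_fun (`[0, last 0 s] : set R) f1 /\
  (\int[lebesgue_measure]_(t in `[0%R, last 0%R s]) (f1 t)%:E
   = (complex.Re (G (last 0 s)) - complex.Re (G 0))%:E)%E.
  apply: (@FTC2_piecewise _ f1 (fun t => complex.Re (G t))) => // i si.
  have [h1 [h2 [ch1 ch2 dh]]] := pw i si.
  have [u0 uv v1] := path_lt_nth_bounds ps si; rewrite ls in v1.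
  have S := sub _ _ u0 v1.
  apply: (@FTC2_itvcc _ _ _ (fun t => complex.Re (G t)) _
    (fun t => complex.Re (phi t) * h1 t - complex.Im (phi t) * h2 t)) => //.
  - move=> t; apply: cvgB; apply: cvgM; by [exact: ch1|exact: ch2|
      exact: (continuous_subspaceW S cf1)|exact: (continuous_subspaceW S cf2)].
  - exact: continuous_subspaceW cG1.
  - by move=> t tuv; have [_ [+ _]] := dh t tuv; rewrite cReM.
  - by move=> t tuv; have [E _] := dh t tuv; rewrite /f1 E cReM.
have [_ I2] : measurable_fun (`[0, last 0 s] : set R) f2 /\
  (\int[lebesgue_measure]_(t in `[0%R, last 0%R s]) (f2 t)%:E
   = (complex.Im (G (last 0 s)) - complex.Im (G 0))%:E)%E.
  apply: (@FTC2_piecewise _ f2 (fun t => complex.Im (G t))) => // i si.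
  have [h1 [h2 [ch1 ch2 dh]]] := pw i si.
  have [u0 uv v1] := path_lt_nth_bounds ps si; rewrite ls in v1.
  have S := sub _ _ u0 v1.
  apply: (@FTC2_itvcc _ _ _ (fun t => complex.Im (G t)) _
    (fun t => complex.Re (phi t) * h2 t + complex.Im (phi t) * h1 t)) => //.
  - move=> t; apply: cvgD; apply: cvgM; by [exact: ch1|exact: ch2|
      exact: (continuous_subspaceW S cf1)|exact: (continuous_subspaceW S cf2)].
  - exact: continuous_subspaceW cG2.
  - by move=> t tuv; have [_ [_ +]] := dh t tuv; rewrite cImM.
  - by move=> t tuv; have [E _] := dh t tuv; rewrite /f2 E cImM.
move: I1 I2; rewrite ls /Rintegral => -> ->.
by case: (G 1) (G 0) => [? ?] [? ?].
Qed.

(** The angle is only assumed continuous. Near [t] it stays within pi/2 of [theta t], so it equals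
    [theta t] plus the arctangent of an explicit quotient of [u] and [v], which is
    differentiable. *)
Lemma is_derive_angle (R : realType) (theta u v : R -> R) (t du dv : R) :
  {for t, continuous theta} ->
  (\forall s \near t, exists r, [/\ 0 < r, u s = r * cos (theta s) &
    v s = r * sin (theta s)]) ->
  is_derive t 1 u du -> is_derive t 1 v dv ->
  is_derive t 1 theta ((u t * dv - du * v t) / (u t ^+ 2 + v t ^+ 2)).
Proof.
move=> ctheta polar hu hv.
have [r0 [r0_gt0 ut vt]] := nbhs_singleton polar.
have nt : u t ^+ 2 + v t ^+ 2 = r0 ^+ 2.
  by rewrite ut vt !exprMn -mulrDr cos2Dsin2 mulr1.
have nt0 : u t * u t + v t * v t != 0.
  by rewrite -!expr2 nt expf_neq0// gt_eqF.
(* Cross product over dot product of the vectors at [t] and [s]: the tangent of the angle between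
   them. *)
pose A s := (v s * u t - u s * v t) * (u s * u t + v s * v t)^-1.
apply: (@near_eq_is_derive _ _ _ (fun s => theta t + atan (A s))).
  near=> s.
  have [r [r_gt0 us vs]] : exists r, [/\ 0 < r, u s = r * cos (theta s) &
    v s = r * sin (theta s)] by near: s.
  have ts : `|theta t - theta s| < pi / 2.
    by near: s; apply: cvgr_dist_lt => //; rewrite divr_gt0// pi_gt0.
  have ts' : theta s - theta t \in `](- (pi / 2)), (pi / 2)[.
    by rewrite in_itv/= -ltr_norml distrC.
  have -> : A s = tan (theta s - theta t).
    have c0 : cos (theta s - theta t) != 0.
      by apply/lt0r_neq0/cos_gt0_pihalf; move: ts'; rewrite in_itv.
    rewrite /A /tan us vs ut vt.
    have -> : r * sin (theta s) * (r0 * cos (theta t)) -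
      r * cos (theta s) * (r0 * sin (theta t)) = r * r0 * sin (theta s - theta t).
      by rewrite sinB; ring.
    have -> : r * cos (theta s) * (r0 * cos (theta t)) +
      r * sin (theta s) * (r0 * sin (theta t)) = r * r0 * cos (theta s - theta t).
      by rewrite cosB; ring.
    by field; rewrite c0 !lt0r_neq0.
  by rewrite tanK// addrC subrK.
have dN : is_derive t 1 (fun s => v s * u t - u s * v t) (dv * u t - du * v t).
  by apply: is_derive_eq; rewrite /GRing.scale /=; ring.
have dD : is_derive t 1 (fun s => u s * u t + v s * v t) (du * u t + dv * v t).
  by apply: is_derive_eq; rewrite /GRing.scale /=; ring.
have dV := @is_deriveV _ (fun s => u s * u t + v s * v t) _ _ _ nt0 dD.
have dA : is_derive t 1 A _ := is_deriveM dN dV.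
have dT : is_derive t 1 (atan \o A) _ := is_derive1_comp (is_derive1_atan (A t)) dA.
have dS : is_derive t 1 (fun s => theta t + atan (A s)) _ :=
  is_deriveD (is_derive_cst (theta t) t 1) dT.
apply: (is_derive_eq dS); rewrite /A /GRing.scale /=.
(* [A] vanishes at [t], where the arctangent has derivative 1. *)
have -> : v t * u t - u t * v t = 0 by ring.
by field; rewrite !expr2 nt0.
Unshelve. all: by end_near. Qed.

Section ContourLinear.
Context {R : realType} (gamma : R -> R[i]).
Implicit Types (f g : R[i] -> R[i]) (v w c z : R[i]).

Lemma is_contour_integral_ext f g v :
  (forall t, 0 <= t <= 1 -> f (gamma t) = g (gamma t)) ->
  is_contour_integral gamma f v -> is_contour_integral gamma g v.
Proof.
move=> fg [phi [G [fphi cphi cG dG Gv]]]; exists phi, G; split=> // t t01.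
by rewrite -fg// fphi.
Qed.

Lemma is_contour_integral0 : is_contour_integral gamma (fun=> 0) 0.
Proof.
exists (fun=> 0), (fun=> 0); split=> //; [exact: ccontinuous_cst..| |].
  by move=> t d _ _; rewrite mul0r; exact: is_cderive_cst.
by rewrite subrr.
Qed.

Lemma is_contour_integralD f g v w :
  is_contour_integral gamma f v -> is_contour_integral gamma g w ->
  is_contour_integral gamma (fun z => f z + g z) (v + w).
Proof.
move=> [phi [F [fphi cphi cF dF Fv]]] [psi [G [gpsi cpsi cG dG Gw]]].
exists (fun t => phi t + psi t), (fun t => F t + G t); split.
- by move=> t t01; rewrite fphi// gpsi.
- exact: ccontinuousD.
- exact: ccontinuousD.
- move=> t d t01 dg; rewrite mulrDl; apply: is_cderiveD.
    exact: dF.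
  exact: dG.
- by rewrite -Fv -Gw; ring.
Qed.

Lemma is_contour_integralZ c f v :
  is_contour_integral gamma f v ->
  is_contour_integral gamma (fun z => c * f z) (c * v).
Proof.
move=> [phi [F [fphi cphi cF dF Fv]]].
exists (fun t => c * phi t), (fun t => c * F t); split.
- by move=> t t01; rewrite fphi.
- exact/ccontinuousM/cphi/ccontinuous_cst.
- exact/ccontinuousM/cF/ccontinuous_cst.
- move=> t d t01 dg.
  have := is_cderiveM (is_cderive_cst c t) (dF t d t01 dg).
  by rewrite mulr0 addr0 mulrA.
- by rewrite -Fv; ring.
Qed.

Hypothesis gammaC : closed_contour gamma.

Let gamma_cont : ccontinuous_on `[0, 1] gamma.
Proof. by case: gammaC. Qed.

Let gamma01 : gamma 1 = gamma 0.
Proof. by case: gammaC. Qed.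

Let gammaB_cont z : ccontinuous_on `[0, 1] (fun t => gamma t - z).
Proof. exact/ccontinuousD/ccontinuous_cst. Qed.

Let gammaB_deriv z t d :
  is_cderive gamma t d -> is_cderive (fun s => gamma s - z) t d.
Proof.
by move=> dg; have := is_cderiveD dg (is_cderive_cst (- z) t); rewrite addr0.
Qed.

Lemma is_contour_integral_pole_gt1 z (k : nat) :
  (forall t, 0 <= t <= 1 -> gamma t != z) ->
  is_contour_integral gamma (fun w => 1 / (w - z) ^+ k.+2) 0.
Proof.
move=> gz.
have g0 t : 0 <= t <= 1 -> gamma t - z != 0 by move=> /gz; rewrite subr_eq0.
have k0 : k.+1%:R != 0 :> R[i] by rewrite pnatr_eq0.
exists (fun t => ((gamma t - z) ^+ k.+2)^-1),
  (fun t => (- k.+1%:R^-1) * ((gamma t - z) ^+ k.+1)^-1); split.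
- by move=> t _; rewrite div1r.
- apply: ccontinuousV; last exact/ccontinuousX/gammaB_cont.
  by move=> t /=; rewrite in_itv/= => /g0; exact: expf_neq0.
- apply: ccontinuousM; first exact: ccontinuous_cst.
  apply: ccontinuousV; last exact/ccontinuousX/gammaB_cont.
  by move=> t /=; rewrite in_itv/= => /g0; exact: expf_neq0.
- move=> t d t01 /(gammaB_deriv z) dg.
  have gt0 : gamma t - z != 0 by apply: g0; case/andP: t01 => /ltW -> /ltW ->.
  have gtk : (gamma t - z) ^+ k.+1 != 0 by exact: expf_neq0.
  have := is_cderiveM (is_cderive_cst (- k.+1%:R^-1) t)
    (is_cderiveV gtk (is_cderiveX k dg)).
  rewrite mulr0 addr0; congr (is_cderive _ _ _).
  rewrite !exprS in gtk *; set x := _ ^+ k in gtk *.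
  have x0 : x != 0 by exact: expf_neq0.
  clearbody x; move: gt0 gtk x0 k0.
  move: (gamma t - z) (k.+1%:R) => y c y0 _ x0 c0; rewrite !expr0.
  by field; rewrite y0 x0 c0.
- by rewrite gamma01 subrr.
Qed.

Lemma is_contour_integral_pole1 z (k : int) : winds gamma z k ->
  is_contour_integral gamma (fun w => 1 / (w - z)) (2 * pi%:C * 'i%C * k%:~R).
Proof.
move=> [gz [theta [ctheta thetaE theta01]]].
have g0 t : 0 <= t <= 1 -> gamma t - z != 0 by move=> /gz; rewrite subr_eq0.
pose u t := complex.Re (gamma t - z); pose v t := complex.Im (gamma t - z).
pose n t := u t ^+ 2 + v t ^+ 2.
have n0 t : 0 <= t <= 1 -> 0 < n t by move=> /g0; exact: sum_sqr_ReIm_gt0.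
have [cu cv] := gammaB_cont z.
(* The primitive is a branch of log (gamma t - z) along the path. Since [n] is the squared modulus,
   half of its logarithm is the real part, which returns to its initial value; the imaginary part
   [theta] grows by 2 pi k. *)
exists (fun t => (gamma t - z)^-1),
  (fun t => (ln (n t) / 2) +i* theta t); split.
- by move=> t _; rewrite div1r.
- apply: ccontinuousV; last exact: gammaB_cont.
  by move=> t /=; rewrite in_itv/= => /g0.
- split=> //=; apply/subspace_continuousP => t /=; rewrite in_itv/= => t01.
  move: cu cv => /subspace_continuousP cu /subspace_continuousP cv.
  apply: cvgM; last exact: cvg_cst.
  apply: continuous_cvg; first exact/continuous_ln/n0.
  apply: cvgD; apply: cvgM; by [exact: cu|exact: cv].
- move=> t d t01 /(gammaB_deriv z) [du dv].
  have t01' : 0 <= t <= 1 by case/andP: t01 => /ltW -> /ltW ->.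
  have nt0 := n0 t t01'.
  split; rewrite /= ?(cReM, cImM, cReV, cImV) -/(u t) -/(v t) -/(n t).
    have dn : is_derive t 1 n (complex.Re d * u t *+ 2 + complex.Im d * v t *+ 2).
      apply: is_derive_eq; rewrite /GRing.scale /= -/(u t) -/(v t).
      by ring.
    have dl : is_derive t 1 (@ln R \o n)
      ((n t)^-1 * (complex.Re d * u t *+ 2 + complex.Im d * v t *+ 2)).
      by apply: is_derive1_comp; exact: is_derive1_ln.
    have dm : is_derive t 1 (fun s => ln (n s) / 2) _ :=
      is_deriveM dl (is_derive_cst (2^-1 : R) t 1).
    apply: (is_derive_eq dm); rewrite /GRing.scale /=.
    by field; exact: lt0r_neq0.
  apply: is_derive_eq.
    apply: (is_derive_angle _ _ du dv).
      have /continuous_within_itvP := ctheta => /(_ ltr01)[+ _ _]; apply.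
      by rewrite in_itv.
    near=> s; exists (Num.sqrt (n s)); rewrite sqrtr_gt0.
    have s01 : 0 <= s <= 1.
      apply: subset_itv_oo_cc; near: s; apply: near_in_itvoo.
      by rewrite in_itv.
    have := thetaE s s01; rewrite n0// normc_def => E.
    by split=> //; rewrite E /= mul0r ?subr0 ?addr0.
  rewrite -/(u t) -/(v t) -/(n t).
  by field; exact: lt0r_neq0.
- have -> : n 1 = n 0 by rewrite /n /u /v gamma01.
  rewrite -(rmorph_int (real_complex R)) -(rmorph_nat (real_complex R) 2).
  apply/eqP; rewrite eq_complex !(cReD, cReN, cImD, cImN, cReM, cImM) /=.
  rewrite theta01; apply/andP; split; apply/eqP; ring.
Unshelve. all: by end_near. Qed.

(** The residue theorem for a sum of partial fractions, with winding numbers [w]: the higher powers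
    have single-valued primitives and contribute 0. *)
Lemma is_contour_integral_pf (s : seq (R[i] * R[i] * nat)) (w : R[i] -> int) :
  (forall q, q \in s -> winds gamma q.1.2 (w q.1.2)) ->
  is_contour_integral gamma (pf_eval s)
    (2 * pi%:C * 'i%C * \sum_(q <- s | q.2 == 0%N) q.1.1 * (w q.1.2)%:~R).
Proof.
elim: s => [_|[[c z] k] s IHs ws].
  rewrite big_nil mulr0.
  apply: is_contour_integral_ext is_contour_integral0 => t _.
  by rewrite /pf_eval big_nil.
have wz : winds gamma z (w z) by apply: (ws (c, z, k)); rewrite mem_head.
have Is : is_contour_integral gamma (pf_eval s)
    (2 * pi%:C * 'i%C * \sum_(q <- s | q.2 == 0%N) q.1.1 * (w q.1.2)%:~R).
  by apply: IHs => q qs; apply: ws; rewrite inE qs orbT.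
have Iz : is_contour_integral gamma (fun t => c * (1 / (t - z) ^+ k.+1))
    (if k == 0%N then 2 * pi%:C * 'i%C * (c * (w z)%:~R) else 0).
  case: k {ws} => [|k] /=.
    have -> : 2 * pi%:C * 'i%C * (c * (w z)%:~R)
      = c * (2 * pi%:C * 'i%C * (w z)%:~R) by ring.
    apply: is_contour_integralZ.
    under [X in is_contour_integral _ X _]eq_fun do rewrite expr1.
    exact: is_contour_integral_pole1.
  rewrite -(mulr0 c); apply: is_contour_integralZ.
  by apply: is_contour_integral_pole_gt1; case: wz.
apply: (@is_contour_integral_ext (fun t => c * (1 / (t - z) ^+ k.+1) + pf_eval s t)).
  by move=> t _; rewrite /pf_eval big_cons mulrA mulr1.
rewrite big_cons /=; have := is_contour_integralD Iz Is.
by case: ifP => _; rewrite ?add0r// mulrDr.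
Qed.

End ContourLinear.

(** * Residues *)

Section Residues.
Context {K : numFieldType}.
Implicit Types (z w t c : K) (s : seq (K * K * nat)).

Lemma derivable_subX z t (k : nat) :
  derivable (fun t : K^o => (t - z) ^+ k : K^o) t 1.
Proof.
elim: k => [|k IHk].
  under [X in derivable X]eq_fun do rewrite expr0.
  exact: derivable_cst.
under [X in derivable X]eq_fun do rewrite exprS.
apply: derivableM IHk.
by apply: derivableB; [exact: derivable_id|exact: derivable_cst].
Qed.

Lemma derivable_continuous (f : K^o -> K^o) (z : K^o) :
  derivable f z 1 -> {for z, continuous f}.
Proof. by move=> /derivable1_diffP; exact: differentiable_continuous. Qed.

Lemma near_neq z w : z != w -> \forall t \near (z : K^o), t != w.
Proof.
move=> zw; have zw0 : (z - w) ^+ 1 != 0 by rewrite expr1 subr_eq0.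
have /cvgr_neq0/(_ zw0) := derivable_continuous (@derivable_subX w z 1).
by apply: filterS => t; rewrite expr1 subr_eq0.
Qed.

Lemma near_punctured_neq z w : \forall t \near (z : K^o)^', t != w.
Proof.
have [<-|zw] := eqVneq z w; first exact: nbhs_dnbhs_neq.
exact/nbhs_dnbhs/near_neq.
Qed.

Lemma derivable_pole c z t (k : nat) : t != z ->
  derivable (fun t : K^o => c / (t - z) ^+ k.+1 : K^o) t 1.
Proof.
move=> tz; apply: derivableM; first exact: derivable_cst.
apply: derivableV; last exact: derivable_subX.
by rewrite expf_neq0// subr_eq0.
Qed.

(** Multiplied by (t - z)^(M + 1), the sum becomes continuous at [z] with value [c M] there, yet it
    is 0 on a punctured neighbourhood; so the top coefficient vanishes. Peeling off top coefficients
    leads down to [c 0]. *)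
Lemma principal_part_eq0 (z : K) (N : nat) (c : nat -> K) (g : K^o -> K^o) :
  {for (z : K^o), continuous g} ->
  (\forall t \near (z : K^o)^',
    \sum_(k < N.+1) c k / (t - z) ^+ k.+1 + g t = 0) -> c 0%N = 0.
Proof.
move=> cg.
have cN0 (M : nat) : (\forall t \near (z : K^o)^',
    \sum_(k < M.+1) c k / (t - z) ^+ k.+1 + g t = 0) -> c M = 0.
  move=> H.
  pose h (t : K^o) : K^o :=
    \sum_(k < M.+1) c k * (t - z) ^+ (M - k) + (t - z) ^+ M.+1 * g t.
  have hz : h z = c M.
    rewrite /h subrr expr0n mul0r addr0 big_ord_recr /= subnn expr0 mulr1.
    rewrite big1 ?add0r// => k _.
    by rewrite expr0n subn_eq0 leqNgt ltn_ord mulr0.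
  rewrite -hz.
  have hc : {for (z : K^o), continuous h}.
    apply: continuousD.
      apply: derivable_continuous.
      have -> : (fun t : K^o => \sum_(k < M.+1) c k * (t - z) ^+ (M - k) : K^o) =
          \sum_(k < M.+1) (fun t : K^o => c k * (t - z) ^+ (M - k) : K^o).
        by rewrite fct_sumE.
      apply: derivable_sum => k.
      by apply: derivableM; [exact: derivable_cst|exact: derivable_subX].
    by apply: continuousM => //; exact/derivable_continuous/derivable_subX.
  have h0 : h t @[t --> (z : K^o)^'] --> (0 : K^o).
    apply: cvg_near_cst; near=> t.
    have tz : t - z != 0.
      by rewrite subr_eq0; near: t; exact: near_punctured_neq.
    have /(congr1 (fun x => (t - z) ^+ M.+1 * x)) :
      \sum_(k < M.+1) c k / (t - z) ^+ k.+1 + g t = 0 by near: t.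
    rewrite mulr0 mulrDr mulr_sumr => E0; rewrite -[RHS]E0 /h; congr (_ + _).
    apply: eq_bigr => k _; rewrite mulrCA; congr (_ * _).
    by rewrite -expfB_cond// ?subSS// ?ltnS ?leq_ord// (negbTE tz) add0n ltnS leq_ord.
  move/continuous_withinNx in hc.
  exact: (@cvg_unique K^o (@norm_hausdorff _ K^o) _ _ _ _ hc h0).
elim: N => [|N IHN] H; first exact: (cN0 0%N).
apply: IHN; move: H (cN0 _ H) => + cN.
by apply: filterS => t; rewrite big_ord_recr /= cN mul0r addr0.
Unshelve. all: by end_near. Qed.

(** The terms with poles elsewhere serve as the holomorphic part in [is_residue]. *)
Lemma near_derivable_pf z s :
  \forall t \near (z : K^o),
    derivable (fun t : K^o => \sum_(q <- s | q.1.2 != z)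
      q.1.1 / (t - q.1.2) ^+ q.2.+1 : K^o) t 1.
Proof.
elim: s => [|[[c w] k] s IHs].
  near=> t; under [X in derivable X]eq_fun do rewrite big_nil.
  exact: derivable_cst.
have [->|wz] := eqVneq w z.
  move: IHs; apply: filterS => t.
  by under [X in _ -> derivable X _ _]eq_fun do rewrite big_cons /= eqxx.
near=> t.
have tw : t != w by near: t; apply: near_neq; rewrite eq_sym.
have d : derivable (fun t : K^o => \sum_(q <- s | q.1.2 != z)
      q.1.1 / (t - q.1.2) ^+ q.2.+1 : K^o) t 1 by near: t.
under [X in derivable X]eq_fun do rewrite big_cons /= wz.
by apply: derivableD => //; exact: derivable_pole.
Unshelve. all: by end_near. Qed.

End Residues.

Lemma is_residue_unique (R : realType) (z r r' : R[i]) (f : R[i] -> R[i]) :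
  is_residue z f r -> is_residue z f r' -> r = r'.
Proof.
move=> [N [c [g [-> dg fE]]]] [N' [c' [g' [-> dg' fE']]]].
(* The two expansions may have different lengths; padding with zero coefficients allows them to be
   subtracted. *)
pose cut (n : nat) (e : nat -> R[i]) (k : nat) := if (k < n)%N then e k else 0.
have pad n M (e : nat -> R[i]) (t : R[i]) : (n <= M)%N ->
    \sum_(k < n) e k / (t - z) ^+ k.+1 = \sum_(k < M) cut n e k / (t - z) ^+ k.+1.
  move=> nM; rewrite (big_ord_widen _ (fun k => e k / (t - z) ^+ k.+1) nM).
  rewrite big_mkcond; apply: eq_bigr => k _; rewrite /cut.
  by case: ifP => _; rewrite ?mul0r.
apply/eqP; rewrite -subr_eq0; apply/eqP.
apply: (@principal_part_eq0 _ z (maxn N N')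
  (fun k => cut N.+1 c k - cut N'.+1 c' k) (fun t => g t - g' t)).
  have cg := derivable_continuous (nbhs_singleton dg).
  have cg' := derivable_continuous (nbhs_singleton dg').
  exact: (continuousB cg cg').
near=> t.
under eq_bigr do rewrite mulrBl.
rewrite sumrB -!pad ?ltnS ?leq_maxl ?leq_maxr// addrACA -opprD.
have <- : f t = \sum_(k < N.+1) c k / (t - z) ^+ k.+1 + g t by near: t.
have <- : f t = \sum_(k < N'.+1) c' k / (t - z) ^+ k.+1 + g' t by near: t.
by rewrite subrr.
Unshelve. all: by end_near. Qed.

(** A punctured neighbourhood of [z] can avoid the finite list [S], so the values of [f] on [S] do
    not matter. Terms at [z] with equal exponent are gathered into one Laurent coefficient. *)
Lemma Residue_pf (R : realType) (S : seq R[i]) (s : seq (R[i] * R[i] * nat))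
    (f : R[i] -> R[i]) (z : R[i]) :
  (forall t, t \notin S -> f t = pf_eval s t) -> Residue z f = pf_res s z.
Proof.
move=> fE; have H : is_residue z f (pf_res s z).
  pose N := \max_(q <- s) q.2.
  exists N, (fun k => \sum_(q <- s | (q.1.2 == z) && (q.2 == k)) q.1.1),
    (fun t => \sum_(q <- s | q.1.2 != z) q.1.1 / (t - q.1.2) ^+ q.2.+1).
  split=> //; first exact: near_derivable_pf.
  near=> t; have tS : t \notin S.
    near: t; elim: S {fE} => [|w S IHS]; first by near=> t.
    near=> t; rewrite inE negb_or; apply/andP; split.
      by near: t; exact: near_punctured_neq.
    by near: t.
  rewrite fE// /pf_eval (bigID (fun q => q.1.2 == z)) /=; congr (_ + _).
  under [RHS]eq_bigr do rewrite mulr_suml big_mkcond.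
  rewrite exchange_big big_mkcond big_seq [RHS]big_seq.
  apply: eq_bigr => q qs; case: eqP => [->|_]; last by rewrite big1.
  have qN : (q.2 < N.+1)%N by rewrite ltnS /N leq_bigmax_seq.
  rewrite -big_mkcond /= (big_pred1 (Ordinal qN))//.
(* [Residue] is a choice among all residues, so uniqueness is needed to identify it. *)
rewrite /Residue; case: xgetP => [r -> Hr|/(_ _ H)//].
exact: is_residue_unique Hr H.
Unshelve. all: by end_near. Qed.

(** * The scattering process *)

Section Process.
Context {R : realType} {m n : nat} {d : measure_display} {T : measurableType d}
  (P : probability T R) (next : {set 'I_m} -> {set 'I_n} -> 'I_m * 'I_n)
  (survives : 'I_m * 'I_n -> set T).
Implicit Types (SA : {set 'I_m}) (SB : {set 'I_n}) (J : {set 'I_m * 'I_n}).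

Definition A_wins_from SA SB : set T :=
  [set w | exists N : nat,
    (iter N (collide next survives w) (SA, SB)).2 = finset.set0].

Lemma A_wins_from_won SA : A_wins_from SA finset.set0 = setT.
Proof. by apply/seteqP; split=> // w _; exists 0%N. Qed.

Lemma A_wins_from_lost SB : SB != finset.set0 ->
  A_wins_from finset.set0 SB = set0.
Proof.
move=> SB0; apply/seteqP; split=> // w [N].
have -> : iter N (collide next survives w) (finset.set0, SB) = (finset.set0, SB).
  by elim: N => //= N ->; rewrite /collide /= eqxx.
by move=> /= /eqP; rewrite (negbTE SB0).
Qed.

Lemma A_wins_from_step SA SB : SA != finset.set0 -> SB != finset.set0 ->
  let p := next SA SB in
  A_wins_from SA SB =
    (survives p `&` A_wins_from SA (SB :\ p.2)%SET) `|`
    (~` survives p `&` A_wins_from (SA :\ p.1)%SET SB).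
Proof.
move=> SA0 SB0 p.
have cE w : collide next survives w (SA, SB) =
    if w \in survives p then (SA, SB :\ p.2)%SET else (SA :\ p.1, SB)%SET.
  by rewrite /collide /= (negbTE SA0) (negbTE SB0).
apply/seteqP; split=> w.
- move=> [[|N]]; first by move=> /= /eqP; rewrite (negbTE SB0).
  rewrite iterSr cE; case: ifPn => [/set_mem wp H|/negP wp H].
    by left; split=> //; exists N.
  by right; split; [move=> wp'; apply: wp; exact: mem_set|exists N].
- move=> [[wp [N H]]|[wp [N H]]]; exists N.+1; rewrite iterSr cE.
    by rewrite mem_set.
  by rewrite memNset.
Qed.

Definition all_survive J : set T := \bigcap_(i in [set i | i \in J]) survives i.

Lemma all_surviveU1 p J :
  all_survive (p |: J)%SET = survives p `&` all_survive J.
Proof.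
apply/seteqP; split=> w.
  move=> H; split; first by apply: H; rewrite /= finset.setU11.
  by move=> i /= iJ; apply: H; rewrite /= finset.in_setU1 iJ orbT.
by move=> [wp H] i /=; rewrite finset.in_setU1 => /predU1P[->//|]; exact: H.
Qed.

Hypothesis next_in : forall SA SB, SA != finset.set0 -> SB != finset.set0 ->
  (next SA SB).1 \in SA /\ (next SA SB).2 \in SB.
Hypothesis hmeas : forall p, measurable (survives p).

Lemma measurable_all_survive J : measurable (all_survive J).
Proof. by apply: fin_bigcap_measurable => //; exact: finite_finset. Qed.

Lemma measurable_A_wins_from SA SB : measurable (A_wins_from SA SB).
Proof.
have [N] := ubnP (#|SA| + #|SB|); elim: N SA SB => // N IHN SA SB lt_N.
have [->|SB0] := eqVneq SB finset.set0.
  by rewrite A_wins_from_won; exact: measurableT.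
have [->|SA0] := eqVneq SA finset.set0.
  by rewrite A_wins_from_lost//; exact: measurable0.
have [p1 p2] := next_in SA0 SB0.
rewrite A_wins_from_step//; apply: measurableU; apply: measurableI => //.
- apply: IHN; move: lt_N; rewrite [#|SB|](cardsD1 (next SA SB).2) p2.
  by rewrite addnCA add1n ltnS.
- exact: measurableC.
- apply: IHN; move: lt_N; rewrite [#|SA|](cardsD1 (next SA SB).1) p1.
  by rewrite -addnA add1n ltnS.
Qed.

Variables (pr : 'I_m * 'I_n -> R) (g : {set 'I_m} -> {set 'I_n} -> R[i]).
Hypothesis hprob : forall p, P (survives p) = (pr p)%:E.
Hypothesis hind : mutually_independent P survives.
Hypothesis g_won : forall SA, SA != finset.set0 -> g SA finset.set0 = 1.
Hypothesis g_lost : forall SB, SB != finset.set0 -> g finset.set0 SB = 0.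
(** Required for every surviving pair, because [g] does not know which pair [next] selects. *)
Hypothesis g_step : forall SA SB j k, j \in SA -> k \in SB ->
  g SA SB = (pr (j, k))%:C * g SA (SB :\ k)%SET
            + (1 - pr (j, k))%:C * g (SA :\ j)%SET SB.

(* Conditioning on the survivals in J, none of which can be consulted any more
   from the state (SA, SB), makes the induction go through. *)
Lemma probability_A_wins_from SA SB J :
  (SA != finset.set0) || (SB != finset.set0) ->
  (forall q, q \in J -> ~~ ((q.1 \in SA) && (q.2 \in SB))) ->
  (fine (P (all_survive J `&` A_wins_from SA SB)))%:C
    = (\prod_(q in J) pr q)%:C * g SA SB.
Proof.
have PE A : measurable A -> P A = (fine (P A))%:E.
  by move=> mA; rewrite fineK// fin_num_measure.
have [N] := ubnP (#|SA| + #|SB|); elim: N SA SB J => // N IHN SA SB J lt_N SAB disj.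
have [SB0|SB0] := eqVneq SB finset.set0.
  (* Independence enters here, at the end of a run: what remains is the probability of a joint
     survival. *)
  rewrite SB0 A_wins_from_won setIT /all_survive hind.
  have -> : (\prod_(i in J) P (survives i) = \prod_(i in J) (pr i)%:E)%E.
    by apply: eq_bigr => i _; exact: hprob.
  by rewrite prodEFin g_won ?mulr1//; move: SAB; rewrite SB0 eqxx orbF.
have [SA0|SA0] := eqVneq SA finset.set0.
  by rewrite SA0 A_wins_from_lost// setI0 measure0 g_lost// mulr0.
have [p1 p2] := next_in SA0 SB0.
have := A_wins_from_step SA0 SB0; set p := next SA SB in p1 p2 *; move=> /= WE.
set W1 := A_wins_from _ (_ :\ _)%SET in WE; set W2 := A_wins_from (_ :\ _)%SET _ in WE.
have ltA : (#|SA| + #|SB :\ p.2|%SET < N)%N.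
  by move: lt_N; rewrite [#|SB|](cardsD1 p.2) p2 addnCA add1n ltnS.
have ltB : (#|SA :\ p.1|%SET + #|SB| < N)%N.
  by move: lt_N; rewrite [#|SA|](cardsD1 p.1) p1 -addnA add1n ltnS.
have pJ : p \notin J.
  by apply/negP => /disj; rewrite p1 p2.
have prJ : \prod_(q in p |: J) pr q = pr p * \prod_(q in J) pr q.
  by rewrite big_setU1.
have I1 : (fine (P (all_survive (p |: J)%SET `&` W1)))%:C =
    (\prod_(q in p |: J) pr q)%:C * g SA (SB :\ p.2)%SET.
  apply: IHN => //; first by rewrite SA0.
  move=> q; rewrite finset.in_setU1 => /predU1P[->|/disj].
    by rewrite finset.in_setD1 eqxx andbF.
  by apply: contra => /andP[->]; rewrite finset.in_setD1 => /andP[].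
have I2 : (fine (P (all_survive J `&` W2)))%:C =
    (\prod_(q in J) pr q)%:C * g (SA :\ p.1)%SET SB.
  apply: IHN => //; first by rewrite SB0 orbT.
  move=> q /disj; apply: contra => /andP[].
  by rewrite finset.in_setD1 => /andP[_ ->].
(* [W2] starts after the death of [p.1], so it never consults [p], and [p] may join the
   conditioning. Subtracting this from [I2] gives the event that [p.1] loses, without independence
   of complements. *)
have I3 : (fine (P (all_survive (p |: J)%SET `&` W2)))%:C =
    (\prod_(q in p |: J) pr q)%:C * g (SA :\ p.1)%SET SB.
  apply: IHN => //; first by rewrite SB0 orbT.
  move=> q; rewrite finset.in_setU1 => /predU1P[->|/disj].
    by rewrite finset.in_setD1 eqxx.
  apply: contra => /andP[].
  by rewrite finset.in_setD1 => /andP[_ ->].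
have mJ := measurable_all_survive J.
have mpJ := measurable_all_survive (p |: J)%SET.
have mW1 : measurable W1 by exact: measurable_A_wins_from.
have mW2 : measurable W2 by exact: measurable_A_wins_from.
have split_event : all_survive J `&` A_wins_from SA SB =
    (all_survive (p |: J)%SET `&` W1) `|`
    ((all_survive J `&` W2) `\` (all_survive (p |: J)%SET `&` W2)).
  rewrite WE all_surviveU1; apply/seteqP; split=> w /=.
    move=> [wJ [[wp w1]|[wp w2]]]; first by left.
    by right; split=> // -[[]].
  move=> [[[wp wJ] w1]|[[wJ w2] H]]; first by split=> //; left.
  by split=> //; right; split=> // wp; apply: H.
have -> : fine (P (all_survive J `&` A_wins_from SA SB)) =
    fine (P (all_survive (p |: J)%SET `&` W1)) +
    (fine (P (all_survive J `&` W2)) -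
     fine (P (all_survive (p |: J)%SET `&` W2))).
  have mI1 := measurableI _ _ mpJ mW1.
  have mI2 := measurableI _ _ mJ mW2.
  have mI3 := measurableI _ _ mpJ mW2.
  have disjoint_split : (all_survive (p |: J)%SET `&` W1) `&`
      ((all_survive J `&` W2) `\` (all_survive (p |: J)%SET `&` W2)) = set0.
    apply/seteqP; split=> // w [[+ _] [[wJ w2] H]].
    by rewrite all_surviveU1 => -[wp _]; apply: H; rewrite all_surviveU1.
  have sub_split : all_survive J `&` W2 `&` (all_survive (p |: J)%SET `&` W2) =
      all_survive (p |: J)%SET `&` W2.
    by rewrite all_surviveU1; apply/seteqP; split=> w /=; tauto.
  rewrite split_event.
  transitivity (fine (P (all_survive (p |: J)%SET `&` W1) +
      (P (all_survive J `&` W2) - P (all_survive (p |: J)%SET `&` W2)))%E).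
    congr fine; rewrite measureU//; last exact: measurableD.
    congr (_ + _)%E; rewrite measureD// ?sub_split//.
    by rewrite ltey_eq fin_num_measure.
  by rewrite (PE _ mI1) (PE _ mI2) (PE _ mI3).
rewrite rmorphD rmorphB /= I1 I2 I3 prJ.
have := g_step p1 p2; rewrite -surjective_pairing => ->.
by rewrite !(rmorphM, rmorphB) /= rmorph1; ring.
Qed.

End Process.

(** The poles lie among the factors present, which shows later that a function without A factors has
    no term at an A pole. Evaluation takes place off a larger [S], so that all sets of survivors
    share one exceptional set. *)
Lemma pf_prod_scale (F : fieldType) (S : seq F) (c w : F) (ws : seq F) :
  {subset w :: ws <= S} ->
  exists s, [/\ pf_poles_in (w :: ws) s,
    forall t, t \notin S -> c * \prod_(v <- w :: ws) (1 / (t - v)) = pf_eval s t &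
    \sum_(q <- s | q.2 == 0%N) q.1.1 = c * (ws == [::])%:R].
Proof.
move=> sub.
have [||s [sS sE s0]] := @pf_prod F (w :: ws) w ws; first exact: mem_head.
  by apply/allP => v vs; rewrite inE vs orbT.
exists [seq (c * q.1.1, q.1.2, q.2) | q <- s]; split.
- by rewrite /pf_poles_in all_map.
- move=> t tS; rewrite sE; last by apply: contra tS; exact: sub.
  rewrite /pf_eval big_map mulr_sumr; apply: eq_bigr => q _ /=.
  by rewrite mulrA.
- by rewrite big_map /= -s0 mulr_sumr.
Qed.

(** * The generating function and its integral *)

Section Scattering.
Context {R : realType} {m n : nat} (a : 'I_m -> R) (b : 'I_n -> R).
Hypotheses (ha : forall j, 0 < a j) (hb : forall k, 0 < b k).
Implicit Types (SA : {set 'I_m}) (SB : {set 'I_n}) (t : R[i]).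

Definition f_from SA SB t : R[i] :=
  (\prod_(j in SA) (1 / (1 + 'i%C * (a j)%:C * t))) *
  (\prod_(k in SB) (1 / (1 - 'i%C * (b k)%:C * t))) * (1 / t).

Definition a_poles SA := [seq 'i%C / (a j)%:C | j <- enum SA].
Definition b_poles SB := [seq - 'i%C / (b k)%:C | k <- enum SB].
Definition poles := 0 :: a_poles [set: 'I_m]%SET ++ b_poles [set: 'I_n]%SET.

Lemma i_mul_i : 'i%C * 'i%C = -1 :> R[i].
Proof. by rewrite -expr2 sqr_i. Qed.

Lemma i_neq0 : 'i%C != 0 :> R[i].
Proof. by rewrite eq_complex /= oner_eq0 andbF. Qed.

Lemma aC_neq0 j : (a j)%:C != 0 :> R[i].
Proof. by rewrite eq_complex /= gt_eqF. Qed.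

Lemma bC_neq0 k : (b k)%:C != 0 :> R[i].
Proof. by rewrite eq_complex /= gt_eqF. Qed.

Lemma a_factor j t : 1 + 'i%C * (a j)%:C * t
  = 'i%C * (a j)%:C * (t - 'i%C / (a j)%:C).
Proof.
rewrite mulrBr mulrACA divff ?aC_neq0//.
by rewrite mulr1 i_mul_i opprK addrC.
Qed.

Lemma b_factor k t : 1 - 'i%C * (b k)%:C * t
  = - ('i%C * (b k)%:C) * (t - - 'i%C / (b k)%:C).
Proof.
rewrite mulrBr !mulNr mulrN !opprK mulrACA divff ?bC_neq0//.
by rewrite mulr1 i_mul_i opprK addrC.
Qed.

Lemma prod_a_factor SA t :
  \prod_(j in SA) (1 / (1 + 'i%C * (a j)%:C * t)) =
  (\prod_(j in SA) ('i%C * (a j)%:C)^-1) * \prod_(v <- a_poles SA) (1 / (t - v)).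
Proof.
rewrite big_map big_enum -big_split; apply: eq_bigr => j _ /=.
by rewrite a_factor !div1r invfM.
Qed.

Lemma prod_b_factor SB t :
  \prod_(k in SB) (1 / (1 - 'i%C * (b k)%:C * t)) =
  (\prod_(k in SB) (- ('i%C * (b k)%:C))^-1) *
  \prod_(v <- b_poles SB) (1 / (t - v)).
Proof.
rewrite big_map big_enum -big_split; apply: eq_bigr => k _ /=.
by rewrite b_factor !div1r invfM.
Qed.

Lemma a_poles_sub SA : {subset a_poles SA <= poles}.
Proof.
move=> v /mapP[j _ ->]; rewrite inE mem_cat; apply/orP; right; apply/orP; left.
by apply: map_f; rewrite mem_enum inE.
Qed.

Lemma b_poles_sub SB : {subset b_poles SB <= poles}.
Proof.
move=> v /mapP[j _ ->]; rewrite inE mem_cat; apply/orP; right; apply/orP; right.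
by apply: map_f; rewrite mem_enum inE.
Qed.

Lemma f_from_pf SA SB : exists s,
  pf_poles_in (0 :: a_poles SA ++ b_poles SB) s /\
  forall t, t \notin poles -> f_from SA SB t = pf_eval s t.
Proof.
pose c := (\prod_(j in SA) ('i%C * (a j)%:C)^-1) *
  (\prod_(k in SB) (- ('i%C * (b k)%:C))^-1).
have [|s [sS sE _]] := @pf_prod_scale _ poles c 0 (a_poles SA ++ b_poles SB).
  move=> v; rewrite inE mem_cat => /or3P[/eqP ->|/a_poles_sub//|/b_poles_sub//].
  exact: mem_head.
exists s; split=> // t tP; rewrite -sE// /f_from prod_a_factor prod_b_factor.
by rewrite big_cons big_cat subr0 /c /=; ring.
Qed.

(** The sign of the imaginary part separates the A poles from the B poles and from 0, whatever the
    speeds. *)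
Lemma Im_a_pole j : 0 < complex.Im ('i%C / (a j)%:C).
Proof.
by rewrite -fmorphV cImM /= mulr0 add0r mul1r invr_gt0.
Qed.

Lemma Im_b_pole k : complex.Im (- 'i%C / (b k)%:C) < 0.
Proof.
by rewrite -fmorphV cImM /= mulr0 add0r mulN1r oppr_lt0 invr_gt0.
Qed.

(** Read as 0 or 1, this is the winding number of the contour around each element of [poles]. *)
Definition on_a_pole (z : R[i]) := z \in a_poles [set: 'I_m]%SET.

Lemma on_a_pole0 : on_a_pole 0 = false.
Proof.
by apply/negP => /mapP[j _ E]; have := Im_a_pole j; rewrite -E ltxx.
Qed.

Lemma on_a_pole_b k : on_a_pole (- 'i%C / (b k)%:C) = false.
Proof.
apply/negP => /mapP[j _ E]; have := Im_a_pole j.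
by rewrite -E ltNge ltW// Im_b_pole.
Qed.

Lemma f_from_step SA SB j k t : j \in SA -> k \in SB -> t \notin poles ->
  f_from SA SB t = (a j / (a j + b k))%:C * f_from SA (SB :\ k)%SET t
    + (1 - a j / (a j + b k))%:C * f_from (SA :\ j)%SET SB t.
Proof.
move=> jA kB tP.
have ab0 : (a j)%:C + (b k)%:C != 0 :> R[i].
  by rewrite -rmorphD eq_complex /= gt_eqF// addr_gt0.
have fa0 : 1 + 'i%C * (a j)%:C * t != 0.
  rewrite a_factor !mulf_neq0 ?i_neq0 ?aC_neq0// subr_eq0.
  apply: contraNneq tP => ->; apply: (@a_poles_sub [set j]%SET).
  by apply: map_f; rewrite mem_enum inE.
have fb0 : 1 - 'i%C * (b k)%:C * t != 0.
  rewrite b_factor mulf_neq0 ?oppr_eq0 ?mulf_neq0 ?i_neq0 ?bC_neq0// subr_eq0.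
  apply: contraNneq tP => ->; apply: (@b_poles_sub [set k]%SET).
  by apply: map_f; rewrite mem_enum inE.
have t0 : t != 0 by apply: contraNneq tP => ->; exact: mem_head.
rewrite /f_from (finset.big_setD1 j jA) (finset.big_setD1 k kB) /=.
have -> : (a j / (a j + b k))%:C = (a j)%:C / ((a j)%:C + (b k)%:C).
  by rewrite fmorph_div rmorphD.
have -> : (1 - a j / (a j + b k))%:C = 1 - (a j)%:C / ((a j)%:C + (b k)%:C).
  by rewrite rmorphB rmorph1 fmorph_div rmorphD.
set A := \prod_(_ in SA :\ _) _; set B := \prod_(_ in SB :\ _) _.
move: ab0 fa0 fb0; move: (a j)%:C (b k)%:C => x y xy fx fy.
by field; rewrite xy t0 fx fy.
Qed.

Section Contour.
Context (C : R -> R[i]).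
Hypotheses (hC : closed_contour C)
  (hCa : forall j, surrounds C ('i%C / (a j)%:C))
  (hC0 : does_not_surround C 0)
  (hCb : forall k, does_not_surround C (- 'i%C / (b k)%:C)).

Lemma winds_pole z : z \in poles -> winds C z (on_a_pole z : nat)%:Z.
Proof.
rewrite inE mem_cat => /or3P[/eqP ->|zA|/mapP[k _ ->]].
- by rewrite on_a_pole0; exact: hC0.
- by rewrite /on_a_pole zA; case/mapP: zA => j _ ->; exact: hCa.
- by rewrite on_a_pole_b; exact: hCb.
Qed.

Lemma contour_not_pole (t : R) : 0 <= t <= 1 -> C t \notin poles.
Proof. by move=> t01; apply/negP => /winds_pole[/(_ t t01)]; rewrite eqxx. Qed.

Lemma is_contour_integral_rational (f : R[i] -> R[i]) s :
  pf_poles_in poles s -> (forall t, t \notin poles -> f t = pf_eval s t) ->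
  is_contour_integral C f (2 * pi%:C * 'i%C *
    \sum_(q <- s | on_a_pole q.1.2 && (q.2 == 0%N)) q.1.1).
Proof.
move=> /allP sP fE.
have := @is_contour_integral_pf _ C hC s (fun z => (on_a_pole z : nat)%:Z).
move=> /(_ (fun q qs => winds_pole (sP q qs))).
have -> : \sum_(q <- s | q.2 == 0%N) q.1.1 * ((on_a_pole q.1.2 : nat)%:Z)%:~R =
    \sum_(q <- s | on_a_pole q.1.2 && (q.2 == 0%N)) q.1.1.
  rewrite big_mkcond [RHS]big_mkcond; apply: eq_bigr => q _.
  by case: on_a_pole; case: eqP; rewrite ?mulr1 ?mulr0.
by apply: is_contour_integral_ext => t t01; rewrite fE// contour_not_pole.
Qed.

(** With [contour_integral] itself as certified value, any linear relation between the integrands on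
    the contour passes to the integrals. *)
Lemma is_contour_integral_f_from SA SB :
  is_contour_integral C (f_from SA SB) (contour_integral C (f_from SA SB)).
Proof.
have [s [sS sE]] := f_from_pf SA SB.
have sP : pf_poles_in poles s.
  apply: sub_all sS => q; rewrite inE mem_cat.
  by case/or3P => [/eqP ->|/a_poles_sub//|/b_poles_sub//]; exact: mem_head.
have H := is_contour_integral_rational sP sE.
by rewrite (contour_integralE hC H).
Qed.

Lemma contour_integral_f_from_step SA SB j k : j \in SA -> k \in SB ->
  contour_integral C (f_from SA SB) =
  (a j / (a j + b k))%:C * contour_integral C (f_from SA (SB :\ k)%SET)
  + (1 - a j / (a j + b k))%:C * contour_integral C (f_from (SA :\ j)%SET SB).
Proof.
move=> jA kB; apply: contour_integralE => //.
apply: is_contour_integral_ext (is_contour_integralD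
  (is_contour_integralZ _ (is_contour_integral_f_from SA (SB :\ k)%SET))
  (is_contour_integralZ _ (is_contour_integral_f_from (SA :\ j)%SET SB))).
by move=> t t01; rewrite -f_from_step// contour_not_pole.
Qed.

(** Without A factors the poles are 0 and B poles, around which the contour has winding number 0. *)
Lemma contour_integral_f_from_lost SB :
  contour_integral C (f_from finset.set0 SB) = 0.
Proof.
have [s [sS sE]] := f_from_pf finset.set0 SB.
have E0 : a_poles finset.set0 = [::] by rewrite /a_poles enum_set0.
rewrite E0 /= in sS.
have sP : pf_poles_in poles s.
  apply: sub_all sS => q; rewrite inE.
  by case/predU1P => [->|/b_poles_sub//]; exact: mem_head.
rewrite (contour_integralE hC (is_contour_integral_rational sP sE)).
rewrite big_seq_cond big1 ?mulr0// => q /and3P[qs qA _].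
have := allP sS q qs; rewrite inE => /predU1P[q0|/mapP[k _ qk]].
  by rewrite q0 on_a_pole0 in qA.
by rewrite qk on_a_pole_b in qA.
Qed.

(** With [h] the product of the A factors, the integrand is that of the survivors other than [j]
    minus i a_j [h]. All poles of [h] are encircled once, so its integral is 0 if at least two
    factors are present and induction applies. For [j] alone it is 2 pi i / (i a_j), while the
    remaining integrand 1/t contributes 0. *)
Lemma contour_integral_f_from_won SA : SA != finset.set0 ->
  contour_integral C (f_from SA finset.set0) = - (2 * pi%:C * 'i%C).
Proof.
have [N] := ubnP #|SA|; elim: N SA => // N IHN SA ltN /finset.set0Pn[j jA].
pose h t := \prod_(i in SA) (1 / (1 + 'i%C * (a i)%:C * t)).
pose c := \prod_(i in SA) ('i%C * (a i)%:C)^-1.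
pose w := 'i%C / (a j)%:C; pose ws := a_poles (SA :\ j)%SET.
have wsP : {subset w :: ws <= a_poles [set: 'I_m]%SET}.
  move=> v; rewrite inE => /predU1P[->|/mapP[i _ ->]];
    by apply: map_f; rewrite mem_enum inE.
have [|s [sS sE s0]] := @pf_prod_scale _ poles c w ws.
  by move=> v /wsP; exact: a_poles_sub.
have Ih : is_contour_integral C h (2 * pi%:C * 'i%C * (c * (ws == [::])%:R)).
  rewrite -s0.
  have -> : \sum_(q <- s | q.2 == 0%N) q.1.1 =
      \sum_(q <- s | on_a_pole q.1.2 && (q.2 == 0%N)) q.1.1.
    rewrite big_seq_cond [RHS]big_seq_cond; apply: eq_bigl => q.
    case: (boolP (q \in s)) => //= qs.
    by have -> : on_a_pole q.1.2 by exact: wsP (allP sS q qs).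
  apply: is_contour_integral_rational.
    by apply: sub_all sS => q /wsP; exact: a_poles_sub.
  move=> t tP; rewrite -sE// /h prod_a_factor; congr (_ * _).
  rewrite /a_poles !big_map !big_enum (finset.big_setD1 j jA) /= big_cons.
  by rewrite big_map big_enum.
have := is_contour_integralD (is_contour_integral_f_from (SA :\ j)%SET finset.set0)
  (is_contour_integralZ (- ('i%C * (a j)%:C)) Ih).
move=> /(@is_contour_integral_ext _ _ _ (f_from SA finset.set0) _ _).
move=> /(_ _)/(contour_integralE hC) ->; last first.
  move=> t t01; have tP := contour_not_pole t01.
  have t0 : C t != 0 by apply: contraNneq tP => ->; exact: mem_head.
  have fa0 : 1 + 'i%C * (a j)%:C * C t != 0.
    rewrite a_factor !mulf_neq0 ?i_neq0 ?aC_neq0// subr_eq0.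
    apply: contraNneq tP => ->; apply: (@a_poles_sub [set j]%SET).
    by apply: map_f; rewrite mem_enum inE.
  rewrite /f_from /h big_set0 (finset.big_setD1 j jA) /=.
  set A := \prod_(_ in _) _.
  by field; rewrite t0 fa0.
have [SAj|SAj] := eqVneq (SA :\ j)%SET finset.set0.
  rewrite SAj contour_integral_f_from_lost add0r /ws /a_poles SAj enum_set0 eqxx.
  rewrite /c (finset.big_setD1 j jA) SAj big_set0 /=.
  by field; rewrite i_neq0 aC_neq0.
rewrite IHN//; last first.
  by move: ltN; rewrite (cardsD1 j) jA.
have -> : (ws == [::]) = false.
  by rewrite -size_eq0 size_map -cardE cards_eq0 (negbTE SAj).
by rewrite !mulr0 addr0.
Qed.

End Contour.
End Scattering.

Unset Implicit Arguments.

Theorem mainTheorem2 (R : realType) (m n : nat)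
  (hm : (1 <= m)%N) (hn : (1 <= n)%N)
  (a : 'I_m -> R) (b : 'I_n -> R)
  (ha : forall j, 0 < a j) (hb : forall k, 0 < b k)
  (* initial positions, and the order of the collisions they determine *)
  (x : 'I_m -> R) (y : 'I_n -> R) (hxy : forall j k, x j < y k)
  (next : {set 'I_m} -> {set 'I_n} -> 'I_m * 'I_n)
  (hnext : next_collision a b x y next)
  (* independent outcomes of the collisions *)
  (d : measure_display) (T : measurableType d) (P : probability T R)
  (survives : 'I_m * 'I_n -> set T)
  (hmeas : forall p, measurable (survives p))
  (hprob : forall j k, P (survives (j, k)) = (a j / (a j + b k))%:E)
  (hind : mutually_independent P survives)
  (* the contour *)
  (C : R -> R[i]) (hC : closed_contour C)
  (hCa : forall j, surrounds C ('i%C / (a j)%:C))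
  (hC0 : does_not_surround C 0)
  (hCb : forall k, does_not_surround C (- 'i%C / (b k)%:C)) :
  (fine (P (A_wins next survives)))%:C
    = - (1 / (2 * pi%:C * 'i%C) * contour_integral C (f_a a b))
  /\
  - (1 / (2 * pi%:C * 'i%C) * contour_integral C (f_a a b))
    (* [undup]: a pole i / a_j shared by several equal speeds counts once *)
    = - \sum_(z <- undup [seq 'i%C / (a j)%:C | j <- enum 'I_m])
          Residue z (f_a a b).

Proof.
have fE : f_a a b = f_from a b finset.setT finset.setT.
  apply/funext => t; rewrite /f_a /f_from; congr (_ * _ * _);
    by apply: eq_bigl => i; rewrite inE.
have K0 : 2 * pi%:C * 'i%C != 0 :> R[i].
  rewrite !mulf_neq0 ?i_neq0 ?pnatr_eq0//.
  by rewrite eq_complex /= gt_eqF// pi_gt0.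
split.
  have setT0 p : (1 <= p)%N -> [set: 'I_p]%SET != finset.set0.
    by move=> p0; rewrite -cards_eq0 cardsT card_ord -lt0n.
  (* At the start nothing has been conditioned on: [J] is empty and its product is 1. *)
  have := @probability_A_wins_from R m n d T P next survives _ hmeas
    (fun p => a p.1 / (a p.1 + b p.2))
    (fun SA SB => - (1 / (2 * pi%:C * 'i%C) * contour_integral C (f_from a b SA SB)))
    _ hind _ _ _ finset.setT finset.setT finset.set0.
  rewrite big_set0 rmorph1 [1 * - _]mul1r fE => <- //.
  - congr (fine (P _))%:C; apply/seteqP; split=> [w wA|w []//].
    by split=> // i /=; rewrite inE.
  - by move=> SA SB SA0 SB0; case: (hnext SA SB SA0 SB0).
  - by case=> j k; exact: hprob.
  - move=> SA SA0; rewrite contour_integral_f_from_won//.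
    by rewrite mulrN opprK div1r mulVf.
  - by move=> SB SB0; rewrite contour_integral_f_from_lost// mulr0 oppr0.
  - move=> SA SB j k jA kB.
    rewrite (contour_integral_f_from_step ha hb hC hCa hC0 hCb jA kB) /=.
    by ring.
  - by rewrite setT0.
  - by move=> q; rewrite inE.
congr (- _); have [s [sS sE]] := f_from_pf ha hb finset.setT finset.setT.
rewrite fE.
rewrite (contour_integralE hC (is_contour_integral_rational ha hb hC hCa hC0 hCb sS sE)).
rewrite mulrA div1r mulVf// mul1r.
under [RHS]eq_bigr do rewrite (Residue_pf _ sE).
(* Each simple-pole term at an A pole is counted once since [undup] removes repetitions; equal
   speeds only raise the order of a pole. *)
rewrite sum_pf_res ?undup_uniq//; apply: eq_bigl => q.
rewrite mem_undup /on_a_pole /a_poles; congr ((_ \in map _ _) && _).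
by apply: eq_enum => j; rewrite inE.
Qed.
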